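(* Let $n\ge 1$ and let $k_1,\dots,k_n\ge 1$ be integers. Let $\mathcal{M}=\{1^{k_1},2^{k_2},\ldots,n^{k_n}\}$ and $K=k_1+k_2+\cdots+k_n$. Then $$\overline{Q}_{\mathcal{M}}(t,u,v)=\frac{n!}{K-n+1}\,[z^n]\bigl(\widetilde{A}(t,u;z)-1+v\bigr)^{K-n+1}.$$
   Context: The notation $\{1^{k_1},\ldots,n^{k_n}\}$ denotes the multiset in which $i$ occurs exactly $k_i$ times. A permutation of a multiset is a linear arrangement (word) of its elements in which each element is used with its multiplicity. A permutation $\pi$ of a multiset is quasi-Stirling if there do not exist indices $i<j<k<\ell$ with $\pi_i=\pi_k$ and $\pi_j=\pi_\ell$. $\overline{\mathcal{Q}}_{\mathcal{M}}$ is the set of quasi-Stirling permutations of the multiset $\mathcal{M}$. For a word $\pi=\pi_1\pi_2\cdots\pi_N$ of positive integers, with the convention $\pi_0=\pi_{N+1}=0$, an index $i$ with $0\le i\le N$ is an ascent (resp. descent, plateau) if $\pi_i<\pi_{i+1}$ (resp. $\pi_i>\pi_{i+1}$, $\pi_i=\pi_{i+1}$); $asc(\pi)$, $des(\pi)$, $plat(\pi)$ are the numbers of ascents, descents, plateaux. $\overline{Q}_{\mathcal{M}}(t,u,v)=\sum_{\pi\in\overline{\mathcal{Q}}_{\mathcal{M}}}t^{des(\pi)}u^{asc(\pi)}v^{plat(\pi)}$. Let $\mathcal{S}_m$ be the set of permutations of $[m]=\{1,\dots,m\}$, $A_m(t,u)=\sum_{\pi\in\mathcal{S}_m}t^{des(\pi)}u^{asc(\pi)}$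 (with the same conventions for $des$ and $asc$), and $\widetilde{A}(t,u;z)=1+\sum_{m\ge 1}A_m(t,u)\frac{z^m}{m!}$, a formal power series in $z$. $[z^n]F$ denotes the coefficient of $z^n$ in $F$.
   Formalization: In the definition of quasi-Stirling the crossing values are required to differ (π_i ≠ π_j, i.e. avoidance of 1212 and 2121); read literally, the claim fails for M={1^4}, where the left side is 0 and the right side is t·u·v^3. *)

(* Defs.v *)
From mathcomp Require Import all_boot all_order all_algebra.
From mathcomp Require Import mpoly.

Set Implicit Arguments.
Unset Strict Implicit.
Unset Printing Implicit Defensive.

Import GRing.Theory.
Local Open Scope ring_scope.

(** Words of positive integers are [seq nat]. [padded w] is
    [0, w_1, ..., w_N, 0]: its entry of index [i] is [w_i], with the
    convention [w_0 = w_{N+1} = 0]. *)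
Definition padded (w : seq nat) : seq nat := (0 :: rcons w 0)%N.

Definition asc (w : seq nat) : nat :=
  #|[set i : 'I_(size w).+1 | (nth 0 (padded w) i < nth 0 (padded w) i.+1)%N]|.

Definition des (w : seq nat) : nat :=
  #|[set i : 'I_(size w).+1 | (nth 0 (padded w) i > nth 0 (padded w) i.+1)%N]|.

Definition plat (w : seq nat) : nat :=
  #|[set i : 'I_(size w).+1 | nth 0%N (padded w) i == nth 0%N (padded w) i.+1]|.

(** The last condition says that the two crossing values are different, i.e.
    that the patterns 1212 and 2121 are avoided; without it no word using some
    letter four times or more would be quasi-Stirling. *)
Definition quasi_stirling (w : seq nat) : bool :=
  ~~ [exists i : 'I_(size w), exists j : 'I_(size w),
      exists k : 'I_(size w), exists l : 'I_(size w),
        [&& (i < j)%N, (j < k)%N, (k < l)%N,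
            nth 0%N w i == nth 0%N w k, nth 0%N w j == nth 0%N w l
          & nth 0%N w i != nth 0%N w j]].

(** The multiset [{1^{k_1}, ..., n^{k_n}}], listed in increasing order; the
    multiplicity of the letter [i.+1] is [k i], for [i : 'I_n]. *)
Definition multiset (n : nat) (k : 'I_n -> nat) : seq nat :=
  flatten [seq nseq (k i) i.+1 | i <- enum 'I_n].

(** [permutations s] lists every rearrangement of [s] exactly once, also when
    [s] has repeated entries. *)
Definition quasi_stirling_perms (n : nat) (k : 'I_n -> nat) : seq (seq nat) :=
  [seq w <- permutations (multiset k) | quasi_stirling w].

Definition Qbar (R : comNzRingType) (n : nat) (k : 'I_n -> nat) (t u v : R) : R :=
  \sum_(w <- quasi_stirling_perms k) t ^+ des w * u ^+ asc w * v ^+ plat w.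

Definition Apoly (R : comNzRingType) (m : nat) (t u : R) : R :=
  \sum_(w <- permutations (iota 1 m)) t ^+ des w * u ^+ asc w.

(** A formal power series in [z] is the sequence of its coefficients, so that
    [[z^n] F] is [F n]; the product is the Cauchy product. *)
Definition fps (R : Type) := nat -> R.

Definition fps_coef (R : Type) (n : nat) (f : fps R) : R := f n.

Definition fps_const (R : nzRingType) (c : R) : fps R :=
  fun n => if n is 0%N then c else 0.

Definition fps_add (R : nzRingType) (f g : fps R) : fps R :=
  fun n => f n + g n.

Definition fps_sub (R : nzRingType) (f g : fps R) : fps R :=
  fun n => f n - g n.

Definition fps_mul (R : nzRingType) (f g : fps R) : fps R :=
  fun n => \sum_(i < n.+1) f i * g (n - i)%N.

Definition fps_exp (R : nzRingType) (f : fps R) (m : nat) : fps R :=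
  iter m (fps_mul f) (fps_const 1).

Definition Atilde (R : comAlgType rat) (t u : R) : fps R :=
  fun m => if m is 0%N then 1 else (m`!%:R^-1 : rat) *: Apoly m t u.


Definition var_t : {mpoly rat[3]} := 'X_(@Ordinal 3 0 isT).
Definition var_u : {mpoly rat[3]} := 'X_(@Ordinal 3 1 isT).
Definition var_v : {mpoly rat[3]} := 'X_(@Ordinal 3 2 isT).

(* Main.v *)
Require Import Defs.
From mathcomp Require Import all_boot all_order all_algebra.
From mathcomp Require Import mpoly.
From mathcomp Require Import zify ring.

(** Write 0 in front of a word and read it on a circle.  A quasi-Stirling word
    is then a noncrossing partition of the circle into its letters, and the
    counts of ascents, descents and plateaux are counts of cyclic steps.  It is
    convenient to allow any root letter [r], foreign to the word, in the place
    of 0: [weight r w] is the monomial of the cyclic word [r w], and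
    [qs_sum r c] is the sum of these weights over the quasi-Stirling words of
    content [c].

    The engine is a peeling identity, [qs_sum_peel].  If [a] occurs at least
    twice, then a word is [L a W a S] with the last two occurrences of [a]
    displayed; noncrossing means that [W] shares no letter with [L a S], so
    that the word amounts to the pair formed by [L a S] and by [W], and the
    cyclic steps of [r L a W a S] are those of [r L a S] together with those of
    [a W].  Hence a sum over words is a sum over the ways to distribute the
    other letters, of a product of two smaller sums, the second one with root
    [a].

    Call excess the quantity [K - n].  By induction on the size of the
    content, the sum depends only on the number of letters and on the excess,
    and not on the root.
    - Excess 0: the words are the permutations of the letters.  Rotating the
      order of the alphabet cyclically until [r] becomes the minimum preserves
      the cyclic ascents and descents, because a cyclic word crosses the level
      [r] upwards as often as downwards ([steps_rotated_rank]).  This gives the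
      Eulerian polynomial.
    - A unit of excess can be moved from a letter [b] to a letter [a]
      ([move_excess]).  Peel [b] in the first content and [a] in the second:
      either the other letter stays on the side of the root, which gives the
      same terms, or it goes to the side of [W], and then the two families of
      terms agree after exchanging the two parts.
    - So all the excess can be put on one letter.  Peeling that letter
      distributes letters of multiplicity 1 only, and the resulting binomial
      convolution is [(F^k)' F = k F' F^k] with [k F' F^k = k/(k+1) (F^(k+1))'],
      read on coefficients ([tree_coefS]).  This is where the shape
      [n!/(K-n+1) [z^n] F^(K-n+1)] comes from. *)

Set Implicit Arguments.
Unset Strict Implicit.
Unset Printing Implicit Defensive.

Import GRing.Theory.
Local Open Scope ring_scope.

(** * Ascents, descents and plateaux as steps of a path *)

Fixpoint steps (e : rel nat) (x : nat) (s : seq nat) : nat :=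
  if s is y :: s' then (e x y + steps e y s')%N else 0%N.

Lemma steps_cat e x s1 s2 :
  steps e x (s1 ++ s2) = (steps e x s1 + steps e (last x s1) s2)%N.
Proof. by elim: s1 x => //= y s1 IH x; rewrite IH addnA. Qed.

Lemma card_steps (e : rel nat) x s :
  #|[set i : 'I_(size s) | e (nth 0%N (x :: s) i) (nth 0%N (x :: s) i.+1)]|
  = steps e x s.
Proof.
rewrite cardsE -sum1_card.
elim: s x => [|y s IH] x /=; first by rewrite big_ord0.
rewrite big_mkcond big_ord_recl /= -IH; congr addn.
by rewrite [RHS]big_mkcond.
Qed.

Lemma asc_steps w : asc w = steps ltn 0 (rcons w 0%N).
Proof. by rewrite -card_steps /asc /padded -(size_rcons w 0%N). Qed.

Lemma des_steps w : des w = steps gtn 0 (rcons w 0%N).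
Proof. by rewrite -card_steps /des /padded -(size_rcons w 0%N). Qed.

Lemma plat_steps w : plat w = steps eq_op 0 (rcons w 0%N).
Proof. by rewrite -card_steps /plat /padded -(size_rcons w 0%N). Qed.

Section Weight.
Variables (R : comNzRingType) (t u v : R).

Definition pweight (x : nat) (s : seq nat) : R :=
  t ^+ steps gtn x s * u ^+ steps ltn x s * v ^+ steps eq_op x s.

Definition weight (r : nat) (w : seq nat) : R := pweight r (rcons w r).

Lemma pweight_cat x s1 s2 :
  pweight x (s1 ++ s2) = pweight x s1 * pweight (last x s1) s2.
Proof.
by rewrite /pweight !steps_cat !exprD (mulrACA (t ^+ _)) [LHS]mulrACA.
Qed.

(** The closed walk from [r] through [L a W a S] is the walk through [L a S]
    with the closed walk from [a] through [W] inserted at [a]. *)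
Lemma weight_insert r a (L W S : seq nat) :
  weight r (L ++ a :: W ++ a :: S) = weight r (L ++ a :: S) * weight a W.
Proof.
rewrite /weight.
have -> : rcons (L ++ a :: W ++ a :: S) r = rcons L a ++ rcons W a ++ rcons S r.
  by rewrite -!cats1 -!catA /= -!catA.
have -> : rcons (L ++ a :: S) r = rcons L a ++ rcons S r.
  by rewrite -!cats1 -!catA.
by rewrite !pweight_cat !last_rcons mulrA mulrAC.
Qed.

Lemma weight0 w : weight 0 w = t ^+ des w * u ^+ asc w * v ^+ plat w.
Proof. by rewrite /weight /pweight des_steps asc_steps plat_steps. Qed.

End Weight.

(** * Crossings and the insertion of a word between two equal letters *)

(** Subsequences behave well under filtering, mapping and concatenation, which
    avoids any reasoning on positions in the sequel. *)
Lemma crossingP (w : seq nat) :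
  reflect (exists x y, x != y /\ subseq [:: x; y; x; y] w)
          (~~ quasi_stirling w).
Proof.
have E : [seq nth 0%N w m | m <- iota 0 (size w)] = w.
  by rewrite map_nth_iota0 // take_size.
rewrite negbK; apply: (iffP idP).
  case/existsP=> i /existsP[j] /existsP[k] /existsP[l].
  case/and5P=> ij jk kl /eqP ik /andP[/eqP jl nij].
  exists (nth 0%N w i), (nth 0%N w j); split=> //.
  rewrite -[X in subseq _ X]E.
  have -> : [:: nth 0%N w i; nth 0%N w j; nth 0%N w i; nth 0%N w j]
          = [seq nth 0%N w m | m <- [:: i : nat; j : nat; k : nat; l : nat]].
    by rewrite /= -ik -jl.
  apply: map_subseq; apply/(subseq_uniqP (iota_uniq _ _)).
  apply: (irr_sorted_eq ltn_trans ltnn); first by rewrite /= ij jk kl.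
    by apply: sorted_filter; [exact: ltn_trans | exact: iota_ltn_sorted].
  move=> m; rewrite mem_filter mem_iota /= add0n !inE.
  case: eqP => [->|_] /=; first by rewrite ltn_ord.
  case: eqP => [->|_] /=; first by rewrite ltn_ord.
  case: eqP => [->|_] /=; first by rewrite ltn_ord.
  by case: eqP => [->|_] //=; rewrite ltn_ord.
case=> x [y [nxy /subseqP [m sm]]].
rewrite -[X in mask _ X]E -map_mask.
have := sorted_mask ltn_trans m (iota_ltn_sorted 0 (size w)).
have : all (fun i => i < size w)%N (mask m (iota 0 (size w))).
  by apply/allP=> i /mem_mask; rewrite mem_iota.
case: (mask m _) => [|i [|j [|k [|l [|? ?]]]]] //=.
case/and5P=> li lj lk ll _ /and4P[ij jk kl _] [xi yj xk yl].
apply/existsP; exists (Ordinal li); apply/existsP; exists (Ordinal lj).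
apply/existsP; exists (Ordinal lk); apply/existsP; exists (Ordinal ll).
by rewrite /= ij jk kl -xi -yj -xk -yl !eqxx.
Qed.

(** Removing [W] from [L a W a S] leaves two adjacent copies of [a]; merging
    them cannot destroy a crossing, which has no two equal neighbours. *)
Lemma alternating_dedup (T : eqType) (a : T) (s L S : seq T) :
  sorted (fun x y => x != y) s ->
  subseq s (L ++ a :: a :: S) -> subseq s (L ++ a :: S).
Proof.
elim: L s => [|b L IH] [|x s] //=; last first.
  case: (x =P b) => [_|_] alt; first by apply: IH; exact: path_sorted alt.
  by move=> ss; apply: IH.
have [->|nxa] := eqVneq x a; last by rewrite (negbTE nxa).
case: s => [|y s] /=; first by rewrite sub0seq.
by case/andP=> nay _; rewrite eq_sym (negbTE nay).
Qed.

(** With [true] for the letters of [W] and [false] for the others, this forbids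
    the crossings that mix a letter of [W] with a letter from outside. *)
Lemma no_return (m p q : nat) :
  ~~ subseq [:: true; false; true]
            (nseq m false ++ nseq p true ++ nseq q false).
Proof.
have F b k : subseq [:: true] (nseq k b) = b && (0 < k)%N.
  by rewrite sub1seq mem_nseq andbC; case: b.
elim: m => [|m IH] //=.
have G k : ~~ subseq [:: false; true] (nseq k true ++ nseq q false).
  by elim: k => [|k IHk] //=; case: q => //= q'; rewrite F.
case: p => [|p] /=; first by case: q {G} => //= q; elim: q.
exact: G.
Qed.

Lemma filter_none (T : eqType) (P : pred T) s :
  all (predC P) s -> [seq x <- s | P x] = [::].
Proof. by rewrite all_predC has_filter negbK => /eqP. Qed.

Lemma quasi_stirling_subseq s w :
  subseq s w -> quasi_stirling w -> quasi_stirling s.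
Proof.
move=> sw; apply: contraLR => /crossingP[x [y [nxy xy_s]]].
by apply/crossingP; exists x, y; split=> //; apply: subseq_trans xy_s sw.
Qed.

(** A letter [x] common to [W] and to [L] or [S] would cross [a], as [x a x a]
    or [a x a x].  Conversely a crossing inside [L a W a S] has both its letters in
    [W], or both outside, or one on each side; the last case is impossible since
    [W] is contiguous. *)
Lemma quasi_stirling_insert a (L W S : seq nat) :
  a \notin W ->
  quasi_stirling (L ++ a :: W ++ a :: S) =
  [&& quasi_stirling (L ++ a :: S), quasi_stirling W
    & all [predC W] (L ++ a :: S)].
Proof.
move=> aW; set w := L ++ a :: W ++ a :: S.
apply/idP/and3P => [qs_w | [qs_LS qs_W disj]].
  split.
  - apply: quasi_stirling_subseq qs_w; apply: cat_subseq => //.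
    exact: (suffix_subseq (a :: W)).
  - apply: quasi_stirling_subseq qs_w.
    apply: subseq_trans (suffix_subseq L _).
    by apply: subseq_trans (subseq_cons _ _); apply: prefix_subseq.
  apply/allP=> x xLS /=; apply: contraTN qs_w => xW; apply/crossingP.
  have nxa : x != a by apply: contraNneq aW => <-.
  move: xLS; rewrite mem_cat inE (negbTE nxa) /= => /orP[xL | xS].
    exists x, a; split=> //.
    apply: (@cat_subseq _ [:: x] [:: a; x; a]); first by rewrite sub1seq.
    apply: (@cat_subseq _ [:: a; x] [:: a] (a :: W)); last first.
      by rewrite sub1seq mem_head.
    by apply: (@cat_subseq _ [:: a] [:: x] [:: a]); rewrite sub1seq // mem_head.
  exists a, x; split; first by rewrite eq_sym.
  apply: subseq_trans (suffix_subseq L _).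
  apply: (@cat_subseq _ [:: a; x] [:: a; x] (a :: W)).
    by apply: (@cat_subseq _ [:: a] [:: x] [:: a]); rewrite sub1seq // mem_head.
  by apply: (@cat_subseq _ [:: a] [:: x] [:: a]); rewrite sub1seq // mem_head.
move: disj; rewrite all_cat /= aW /= => /andP[disjL disjS].
have inF s : all [predC W] s -> [seq z <- s | z \in W] = [::].
  exact: filter_none.
have outF s : all [predC W] s -> [seq z <- s | z \notin W] = s.
  by move=> /all_filterP.
have map_w : [seq mem W z | z <- w]
    = nseq (size L).+1 false ++ nseq (size W) true ++ nseq (size S).+1 false.
  have cst b s : all [pred z | (z \in W) == b] s ->
      [seq mem W z | z <- s] = nseq (size s) b.
    by elim: s => //= z s IH /andP[/eqP -> /IH ->].
  have out s : all [predC W] s -> all [pred z | (z \in W) == false] s.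
    by apply: sub_all => z /= /negbTE ->.
  rewrite /w -cat_rcons !map_cat (cst true W); last by apply/allP => z /= ->.
  rewrite (cst false); last by rewrite out // all_rcons /= aW.
  by rewrite size_rcons (cst false) // out //= aW.
apply/contraT => /crossingP[x [y [nxy xy_w]]].
case xW: (x \in W); case yW: (y \in W).
- have : subseq [:: x; y; x; y] [seq z <- w | z \in W].
    by rewrite subseq_filter /= xW yW.
  rewrite filter_cat /= (negbTE aW) filter_cat /= (negbTE aW).
  rewrite (inF L) // (inF S) //= cats0.
  rewrite (_ : [seq _ <- W | _] = W) => [xy_W|]; last by apply/all_filterP/allP.
  by case/crossingP: qs_W; exists x, y.
- have := map_subseq (mem W) xy_w; rewrite /= xW yW map_w.
  move/(subseq_trans (prefix_subseq [:: true; false; true] [:: false])).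
  by rewrite (negbTE (no_return _ _ _)).
- have := map_subseq (mem W) xy_w; rewrite /= xW yW map_w.
  move/(subseq_trans (subseq_cons [:: true; false; true] false)).
  by rewrite (negbTE (no_return _ _ _)).
have : subseq [:: x; y; x; y] [seq z <- w | z \notin W].
  by rewrite subseq_filter /= xW yW.
rewrite filter_cat /= aW filter_cat /= aW (outF L) // (outF S) //=.
rewrite (_ : [seq _ <- W | _] = [::]) => [xy_LS|]; last first.
  by apply: filter_none; apply/allP => z /= ->.
case/crossingP: qs_LS; exists x, y; split=> //.
by apply: alternating_dedup xy_LS; rewrite /= nxy eq_sym nxy.
Qed.

(** * Contents and their splittings *)

(** A pair [(x, e)] stands for a letter [x] of multiplicity [e.+1]: storing the
    excess makes all multiplicities positive and turns [K - n] into a sum. *)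
Definition content := seq (nat * nat).

Definition expand (c : content) : seq nat :=
  flatten [seq nseq p.2.+1 p.1 | p <- c].

Lemma expand_cons p c : expand (p :: c) = nseq p.2.+1 p.1 ++ expand c.
Proof. by []. Qed.

Lemma mem_expand c x : (x \in expand c) = (x \in unzip1 c).
Proof.
by elim: c => // p c IH; rewrite expand_cons mem_cat mem_nseq IH inE.
Qed.

Lemma expand_cat c1 c2 : expand (c1 ++ c2) = expand c1 ++ expand c2.
Proof. by rewrite /expand map_cat flatten_cat. Qed.

Lemma filter_expand (P : pred nat) c :
  [seq x <- expand c | P x] = expand [seq p <- c | P p.1].
Proof.
elim: c => // p c IH; rewrite expand_cons filter_cat filter_nseq IH /=.
by case: (P p.1); rewrite ?mul1n ?expand_cons.
Qed.

Lemma perm_expand c1 c2 : perm_eq c1 c2 -> perm_eq (expand c1) (expand c2).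
Proof.
by move=> /(perm_map (fun p : nat * nat => nseq p.2.+1 p.1)) /perm_flatten.
Qed.

Definition excess (c : content) : nat := sumn (unzip2 c).

Lemma excess_cons p c : excess (p :: c) = (p.2 + excess c)%N.
Proof. by []. Qed.

Lemma perm_swap (S : eqType) (x y : S) s : perm_eq (x :: y :: s) (y :: x :: s).
Proof. by apply/permP=> P /=; rewrite addnCA. Qed.

Lemma excess_cat A B : excess (A ++ B) = (excess A + excess B)%N.
Proof. by rewrite /excess /unzip2 map_cat sumn_cat. Qed.

Lemma excess_perm A B : perm_eq A B -> excess A = excess B.
Proof. by move=> AB; apply: perm_sumn; apply: perm_map. Qed.

Lemma excess_gt0 c : (0 < excess c)%N ->
  exists a e c', perm_eq c ((a, e.+1) :: c').
Proof.
elim: c => // -[a [|e]] c IH; rewrite excess_cons /= => pos; last first.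
  by exists a, e, c.
have [b [g [c' p]]] := IH pos; exists b, g, ((a, 0%N) :: c').
apply: (@perm_trans _ ((a, 0%N) :: (b, g.+1) :: c')).
  by rewrite perm_cons.
exact: perm_swap.
Qed.

(** The pairs of complementary subsequences of a sequence. *)
Fixpoint splits (T : Type) (s : seq T) : seq (seq T * seq T) :=
  if s is x :: s' then
    [seq (x :: AB.1, AB.2) | AB <- splits s'] ++
    [seq (AB.1, x :: AB.2) | AB <- splits s']
  else [:: ([::], [::])].

Section Splits.
Variable T : eqType.
Implicit Types (s A B : seq T) (P : pred T).

Lemma splits_perm s A B : (A, B) \in splits s -> perm_eq (A ++ B) s.
Proof.
elim: s A B => [|x s IH] A B /=; first by rewrite inE => /eqP[-> ->].
rewrite mem_cat => /orP[] /mapP[[A' B'] /IH/= AB [-> ->]].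
  by rewrite perm_cons.
by rewrite -cat_rcons -cats1 -catA perm_catCA perm_cons.
Qed.

Lemma splits_uniq s : uniq s -> uniq (splits s).
Proof.
elim: s => //= x s IH /andP[xs /IH us].
rewrite cat_uniq !map_inj_uniq ?us; last 2 first.
- by move=> [A B] [A' B'] /= [-> ->].
- by move=> [A B] [A' B'] /= [-> ->].
rewrite andbT; apply/hasPn => _ /mapP[[A B] /splits_perm ABs ->] /=.
apply: contra xs => /mapP[[A' B'] _ [eqA _]].
by rewrite -(perm_mem ABs) /= eqA mem_head.
Qed.

Lemma mem_splits_filter P s :
  ([seq x <- s | P x], [seq x <- s | ~~ P x]) \in splits s.
Proof.
elim: s => [|x s IH] /=; first by rewrite inE.
rewrite mem_cat; case: (P x) => /=; apply/orP; [left | right];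
  by apply/mapP; eexists; first exact: IH.
Qed.

(** A splitting is determined by any predicate that separates its two parts;
    this makes the content of [W] readable from [W] itself. *)
Lemma splits_filter P s A B :
  (A, B) \in splits s -> all P A -> all (predC P) B ->
  A = [seq x <- s | P x] /\ B = [seq x <- s | ~~ P x].
Proof.
elim: s A B => [|x s IH] A B /=; first by rewrite inE => /eqP[-> ->].
rewrite mem_cat => /orP[] /mapP[[A' B'] /IH/= AB [-> ->]] /=.
  by case/andP=> Px PA PB; rewrite Px; have [-> ->] := AB PA PB.
by move=> PA /andP[/negbTE Px PB]; rewrite Px; have [-> ->] := AB PA PB.
Qed.

Lemma big_splits_swap (V : nmodType) s (h : seq T -> seq T -> V) :
  \sum_(AB <- splits s) h AB.1 AB.2 = \sum_(AB <- splits s) h AB.2 AB.1.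
Proof.
elim: s h => [|x s IH] h /=; first by rewrite !big_seq1.
rewrite !big_cat !big_map /= addrC (IH (fun A B => h A (x :: B))).
by rewrite (IH (fun A B => h (x :: A) B)).
Qed.

End Splits.

(** * Peeling off the last gap of a letter *)

(** [insert_last a W (L a S)] is [L a W a S] when [a] does not occur in [S]. *)
Fixpoint insert_last (a : nat) (W w : seq nat) : seq nat :=
  if w is x :: s then
    if (x == a) && (a \notin s) then a :: W ++ a :: s
    else x :: insert_last a W s
  else [::].

Lemma insert_lastE a W L S :
  a \notin S -> insert_last a W (L ++ a :: S) = L ++ a :: W ++ a :: S.
Proof.
move=> aS; elim: L => [|x L IH] /=; first by rewrite eqxx aS.
by rewrite mem_cat mem_head orbT andbF IH.
Qed.

Lemma last_occurrence a (w : seq nat) :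
  a \in w -> exists L S, w = L ++ a :: S /\ a \notin S.
Proof.
elim: w => //= x w IH; rewrite inE; case: (boolP (a \in w)) => [aw _|aw].
  by have [L [S [-> aS]]] := IH aw; exists (x :: L), S.
by rewrite orbF => /eqP <-; exists [::], w.
Qed.

Lemma last_occurrence_inj a (L1 L2 S1 S2 : seq nat) :
  a \notin S1 -> a \notin S2 -> L1 ++ a :: S1 = L2 ++ a :: S2 ->
  L1 = L2 /\ S1 = S2.
Proof.
move=> aS1 aS2; elim: L1 L2 => [|x L1 IH] [|y L2] /=.
- by case=> ->.
- by case=> _ E; move: aS1; rewrite E mem_cat mem_head orbT.
- by case=> _ E; move: aS2; rewrite -E mem_cat mem_head orbT.
by case=> -> /IH[-> ->].
Qed.

Definition qs_words (c : content) : seq (seq nat) :=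
  [seq w <- permutations (expand c) | quasi_stirling w].

Lemma mem_qs_words c w :
  (w \in qs_words c) = quasi_stirling w && perm_eq w (expand c).
Proof. by rewrite mem_filter mem_permutations. Qed.

Lemma qs_words_uniq c : uniq (qs_words c).
Proof. by rewrite filter_uniq ?permutations_uniq. Qed.

Lemma mem_qs_word c w x : w \in qs_words c -> (x \in w) = (x \in unzip1 c).
Proof.
by rewrite mem_qs_words => /andP[_ /perm_mem ->]; rewrite mem_expand.
Qed.

(** The bijection behind the peeling identity: a word in which [a] has
    multiplicity at least 2 is cut at its last two occurrences of [a].  The
    splitting of the content records which letters lie in the gap. *)
Lemma qs_words_peel a e c : uniq (a :: unzip1 c) ->
  perm_eq (qs_words ((a, e.+1) :: c))
    [seq insert_last a p.2.2 p.2.1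
       | p <- [seq (AB, q) | AB <- splits c,
                 q <- [seq (w, W) | w <- qs_words ((a, e) :: AB.1),
                                    W <- qs_words AB.2]]].
Proof.
move=> /= /andP[ac uc]; set Y := [seq (_, _) | AB <- _, q <- _].
have memY p : p \in Y -> exists A B L S W,
  [/\ p = ((A, B), (L ++ a :: S, W)), (A, B) \in splits c, a \notin S,
      L ++ a :: S \in qs_words ((a, e) :: A) & W \in qs_words B].
  case/allpairsPdep=> [[A B] [_ [AB /allpairsP[[w W] /= [wA WB ->]] ->]]].
  have aw : a \in w by rewrite (mem_qs_word _ wA) mem_head.
  have [L [S [def_w aS]]] := last_occurrence aw.
  by exists A, B, L, S, W; rewrite -def_w.
have disj A B : (A, B) \in splits c ->
    [/\ a \notin unzip1 A, a \notin unzip1 B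
      & forall x, x \in unzip1 B -> x \notin unzip1 A].
  move=> /splits_perm/(perm_map fst); rewrite map_cat => pAB.
  move: (uc) (ac); rewrite -(perm_uniq pAB) -(perm_mem pAB).
  rewrite cat_uniq mem_cat negb_or.
  by case/and3P=> _ /hasPn dAB _ /andP[aA aB]; split=> // x /dAB.
apply: uniq_perm; first exact: qs_words_uniq.
  rewrite map_inj_in_uniq.
    apply: allpairs_uniq_dep.
    - by apply: splits_uniq; exact: (map_uniq uc).
    - move=> AB _; apply: allpairs_uniq; try exact: qs_words_uniq.
      by move=> [? ?] [? ?] _ _ /= [-> ->].
    by move=> [? ?] [? ?] _ _ /= [-> ->].
  move=> p p' /memY[A [B [L [S [W [-> AB aS wA WB]]]]]].
  move=> /memY[A' [B' [L' [S' [W' [-> AB' aS' wA' WB']]]]]] /=.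
  have [aA aB dAB] := disj _ _ AB; have [aA' aB' dAB'] := disj _ _ AB'.
  rewrite !insert_lastE // -!cat_cons !catA.
  move=> eqw; have [eqLW eqS] := last_occurrence_inj aS aS' eqw.
  have aW : a \notin W by rewrite (mem_qs_word _ WB).
  have aW' : a \notin W' by rewrite (mem_qs_word _ WB').
  have [eqL eqW] := last_occurrence_inj aW aW' eqLW.
  rewrite eqL eqS -eqW; congr (_, _).
  have key (A0 B0 : content) : (A0, B0) \in splits c -> W \in qs_words B0 ->
      A0 = [seq p <- c | p.1 \notin W] /\ B0 = [seq p <- c | ~~ (p.1 \notin W)].
    move=> AB0 WB0; have [_ _ dAB0] := disj _ _ AB0.
    apply: (@splits_filter _ (fun p => p.1 \notin W)) => //;
      apply/allP=> z zA /=.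
      rewrite (mem_qs_word _ WB0); apply: contraL (map_f fst zA); exact: dAB0.
    by rewrite negbK (mem_qs_word _ WB0) map_f.
  have [-> ->] := key A B AB WB.
  by rewrite -eqW in WB'; have [-> ->] := key A' B' AB' WB'.
move=> w; apply/idP/mapP; last first.
  move=> [_ /memY[A [B [L [S [W [-> AB aS wA WB]]]]]] ->].
  have [aA aB dAB] := disj _ _ AB.
  rewrite /= insert_lastE //.
  have aW : a \notin W by rewrite (mem_qs_word _ WB).
  rewrite mem_qs_words quasi_stirling_insert //.
  move: (wA) (WB); rewrite !mem_qs_words => /andP[-> pA] /andP[-> pB] /=.
  apply/andP; split.
    apply/allP=> x /=; rewrite (mem_qs_word _ wA) (mem_qs_word _ WB) inE.
    case/orP=> [/eqP->//|xA].
    by apply: contraL xA; exact: dAB.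
  have pw : perm_eq (L ++ a :: W ++ a :: S) (a :: (L ++ a :: S) ++ W).
    by apply/permP=> P; rewrite /= !count_cat /= !count_cat /=; lia.
  apply: (perm_trans pw); rewrite [expand _]/= perm_cons.
  apply: (perm_trans (perm_cat pA pB)).
  rewrite -expand_cat; apply: (@perm_expand ((a, e) :: A ++ B) ((a, e) :: c)).
  by rewrite perm_cons splits_perm.
rewrite mem_qs_words => /andP[qs_w perm_w].
have aw : a \in w by rewrite (perm_mem perm_w) mem_head.
have [L0 [S [def_w aS]]] := last_occurrence aw.
have aL0 : a \in L0.
  have := permP perm_w (pred1 a); rewrite def_w count_cat /= eqxx.
  rewrite (count_memPn aS) addn0 addn1 !add1n => -[E].
  by rewrite -has_pred1 has_count E.
have [L [W [def_L0 aW]]] := last_occurrence aL0.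
have {}def_w : w = L ++ a :: W ++ a :: S by rewrite def_w def_L0 -catA.
move: qs_w; rewrite def_w quasi_stirling_insert // => /and3P[qs_LS qs_W disjW].
move: (disjW); rewrite all_cat /= aW /= => /andP[disjL disjS].
pose A := [seq p <- c | p.1 \notin W].
pose B := [seq p <- c | ~~ (p.1 \notin W)].
exists ((A, B), (L ++ a :: S, W)); last by rewrite /= insert_lastE.
apply/allpairsPdep; exists (A, B), (L ++ a :: S, W); split=> //.
  exact: mem_splits_filter.
apply: allpairs_f; rewrite mem_qs_words ?qs_LS ?qs_W /=.
  have := perm_filter (fun x => x \notin W) perm_w.
  rewrite filter_expand /= aW -/A def_w.
  rewrite filter_cat /= aW filter_cat /= aW.
  move/all_filterP: disjL => ->; move/all_filterP: disjS => ->.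
  rewrite (_ : [seq _ <- W | _] = [::]) /=; last first.
    by apply: filter_none; apply/allP => z /= ->.
  rewrite [expand _]/= => pLS.
  have : perm_eq (a :: L ++ a :: S) (L ++ a :: a :: S).
    by apply/permP=> P; rewrite /= !count_cat /=; lia.
  by move/perm_trans => /(_ _ pLS); rewrite perm_cons.
have := perm_filter (fun x => ~~ (x \notin W)) perm_w.
rewrite filter_expand /= aW -/B def_w.
rewrite filter_cat /= aW filter_cat /= aW.
have out s : all [predC W] s -> [seq x <- s | ~~ (x \notin W)] = [::].
  by move=> /allP dj; apply: filter_none; apply/allP => z /dj /= ->.
rewrite (out L) // (out S) // cats0 (_ : [seq _ <- W | _] = W) //.
by apply/all_filterP/allP => z; rewrite negbK.
Qed.

Section QsSum.
Variables (R : comNzRingType) (t u v : R).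

Definition qs_sum (r : nat) (c : content) : R :=
  \sum_(w <- qs_words c) weight t u v r w.

Lemma qs_sum_perm r c1 c2 : perm_eq c1 c2 -> qs_sum r c1 = qs_sum r c2.
Proof.
move=> c12; apply: perm_big.
by apply: perm_filter; apply: perm_permutations; apply: perm_expand.
Qed.

Lemma qs_sum_peel r a e c : uniq (a :: unzip1 c) ->
  qs_sum r ((a, e.+1) :: c) =
  \sum_(AB <- splits c) qs_sum r ((a, e) :: AB.1) * qs_sum a AB.2.
Proof.
move=> uac; rewrite /qs_sum (perm_big _ (qs_words_peel e uac)) big_map.
rewrite big_allpairs_dep /=.
apply: eq_big_seq => -[A B] AB /=.
rewrite big_allpairs big_distrlr /=; apply: eq_big_seq => w wA.
apply: eq_big_seq => W WB.
have aw : a \in w by rewrite (mem_qs_word _ wA) mem_head.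
have [L [S [-> aS]]] := last_occurrence aw.
by rewrite insert_lastE // weight_insert.
Qed.

End QsSum.

(** * Words without repetition and cyclic rotation of the alphabet *)

Lemma perm_permutations_map (T1 T2 : eqType) (g : T1 -> T2) (s : seq T1) :
  uniq s -> {in s &, injective g} ->
  perm_eq [seq map g w | w <- permutations s] (permutations (map g s)).
Proof.
move=> us inj_g.
have uL : uniq [seq map g w | w <- permutations s].
  rewrite map_inj_in_uniq ?permutations_uniq // => w1 w2.
  rewrite !mem_permutations => /perm_mem s1 /perm_mem s2.
  by apply: (inj_in_map inj_g); apply/allP=> x; rewrite ?s1 ?s2.
have ums : uniq (map g s) by rewrite map_inj_in_uniq.
apply: uniq_perm; rewrite ?permutations_uniq //.
have sub : {subset [seq map g w | w <- permutations s]
                  <= permutations (map g s)}.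
  by move=> _ /mapP[w + ->]; rewrite !mem_permutations; apply: perm_map.
have [|_ //] := uniq_min_size uL sub.
by rewrite size_map !size_permutations // size_map.
Qed.

Lemma ltn_rank (f : nat -> nat) (l : seq nat) x y : x \in l ->
  (count (fun z => f z < f x) l < count (fun z => f z < f y) l)%N
  = (f x < f y)%N.
Proof.
move=> xl; have [fxy | fyx] := ltnP (f x) (f y); last first.
  by apply/negbTE; rewrite -leqNgt; apply: sub_count => z /= /leq_trans -> //.
apply: (@leq_trans (count (predU (fun z => f z < f x)%N (pred1 x)) l));
  last first.
  by apply: sub_count => z /= /orP[/ltn_trans->//|/eqP->].
have := count_predUI (fun z => f z < f x)%N (pred1 x) l.
rewrite [count (predI _ _) _](_ : _ = 0%N); last first.
  rewrite -(count_pred0 l); apply: eq_count => z /=.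
  by case: eqP => [->|]; rewrite ?ltnn ?andbF.
by rewrite addn0 => ->; rewrite -addn1 leq_add2l -has_count has_pred1.
Qed.

Section Rotation.
Variables (r : nat) (s : seq nat).
Hypothesis urs : uniq (r :: s).

(** The order induced by [rotate] on [r :: s] is the cyclic rotation of the
    usual order that starts at [r]: letters below [r] are moved above all the
    others. *)
Definition rotate (z : nat) : nat := (z + (z < r) * (sumn (r :: s)).+1)%N.

Definition rotated_rank (y : nat) : nat :=
  count (fun z => rotate z < rotate y)%N (r :: s).

Let le_sumn z : z \in r :: s -> (z <= sumn (r :: s))%N.
Proof.
elim: (r :: s) => //= y l IH; rewrite inE => /orP[/eqP->|/IH]; lia.
Qed.

(** A step changes from ascent to descent or back exactly when it crosses the
    level [r]; the two correction terms telescope along a path. *)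
Lemma ltn_rotated_rank x y : x \in r :: s -> y \in r :: s ->
  ((rotated_rank x < rotated_rank y) + (x < r) = (x < y) + (y < r))%N.
Proof.
move=> xs ys; rewrite ltn_rank // /rotate.
have := le_sumn xs; have := le_sumn ys.
by case: (ltnP x r); case: (ltnP y r); rewrite ?mul1n ?mul0n; lia.
Qed.

Lemma rotated_rank_root : rotated_rank r = 0%N.
Proof.
rewrite /rotated_rank -[RHS](count_pred0 (r :: s)).
apply: eq_in_count => z zs /=.
rewrite /rotate ltnn; have := le_sumn zs; have := le_sumn (mem_head r s).
by case: (ltnP z r); rewrite ?mul1n ?mul0n; lia.
Qed.

Lemma rotated_rank_inj : {in r :: s &, injective rotated_rank}.
Proof.
move=> x y xs ys exy.
have := ltn_rotated_rank xs ys; have := ltn_rotated_rank ys xs.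
by rewrite exy ltnn; lia.
Qed.

Lemma perm_rotated_rank : perm_eq (map rotated_rank s) (iota 1 (size s)).
Proof.
have us : uniq (map rotated_rank s).
  rewrite map_inj_in_uniq; first by case/andP: urs.
  by move=> x y xs ys; apply: rotated_rank_inj; rewrite inE ?xs ?ys orbT.
apply: uniq_perm; rewrite ?iota_uniq //.
have sub : {subset map rotated_rank s <= iota 1 (size s)}.
  move=> _ /mapP[x xs ->]; rewrite mem_iota add1n !ltnS.
  have xrs : x \in r :: s by rewrite inE xs orbT.
  have xr : x != r by apply: contraTneq xs => ->; case/andP: urs.
  have := ltn_rotated_rank (mem_head r s) xrs; rewrite rotated_rank_root.
  rewrite -[in X in _ && X]ltnS -[(size s).+1]/(size (r :: s)).
  have := count_predC (fun z => rotate z < rotate x)%N (r :: s).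
  have : (0 < count (predC (fun z => rotate z < rotate x)%N) (r :: s))%N.
    by rewrite -has_count; apply/hasP; exists x => //=; rewrite ltnn.
  rewrite -/(rotated_rank x); lia.
have [|_ //] := uniq_min_size us sub.
by rewrite size_map size_iota.
Qed.

(** The corrections of [ltn_rotated_rank] cancel because the path is closed. *)
Lemma steps_rotated_rank (w : seq nat) : {subset w <= s} ->
  let w' := rcons (map rotated_rank w) 0%N in
  [/\ steps ltn r (rcons w r) = steps ltn 0 w',
      steps gtn r (rcons w r) = steps gtn 0 w'
    & steps eq_op r (rcons w r) = steps eq_op 0 w'].
Proof.
move=> ws; rewrite /= -rotated_rank_root -map_rcons.
have {ws} : {subset rcons w r <= r :: s}.
  by move=> x; rewrite mem_rcons !inE => /orP[->//|/ws ->]; rewrite orbT.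
have : last r (rcons w r) = r by rewrite last_rcons.
have : r \in r :: s by rewrite mem_head.
have gen x l : x \in r :: s -> {subset l <= r :: s} ->
 [/\ (steps ltn (rotated_rank x) (map rotated_rank l) + (x < r)
      = steps ltn x l + (last x l < r))%N,
     (steps gtn (rotated_rank x) (map rotated_rank l) + (last x l < r)
      = steps gtn x l + (x < r))%N
   & steps eq_op (rotated_rank x) (map rotated_rank l) = steps eq_op x l].
  elim: l x => //= y l IH x xs ls.
  have ys : y \in r :: s by apply: ls; rewrite mem_head.
  have [|e1 e2 e3] := IH y ys.
    by move=> z zl; apply: ls; rewrite inE zl orbT.
  rewrite (inj_in_eq rotated_rank_inj) // e3.
  have := ltn_rotated_rank xs ys; have := ltn_rotated_rank ys xs.
  by split=> //; lia.
move=> rs lr ls; have [] := gen r _ rs ls; rewrite lr => e1 e2 e3.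
by split; lia.
Qed.

End Rotation.

Section Base.
Variables (R : comNzRingType) (t u v : R).

Lemma quasi_stirling_uniq w : uniq w -> quasi_stirling w.
Proof.
move=> uw; apply/contraT => /crossingP[x [y [_ /subseq_uniq]]].
by move=> /(_ uw) /=; rewrite !inE eqxx orbT.
Qed.

Lemma expand_excess0 c : excess c = 0%N -> expand c = unzip1 c.
Proof.
elim: c => // -[a e] c IH; rewrite excess_cons /= => /eqP.
rewrite addn_eq0 => /andP[/eqP -> /eqP c0].
by rewrite expand_cons IH.
Qed.

Lemma plat_uniq w : uniq w -> 0%N \notin w -> w != [::] -> plat w = 0%N.
Proof.
rewrite plat_steps => uw w0.
have gen x l : uniq (x :: l) -> 0%N \notin x :: l ->
    steps eq_op x (rcons l 0%N) = 0%N.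
  elim: l x => [|y l IH] x /=; first by rewrite inE eq_sym => _ /negbTE ->.
  rewrite !inE !negb_or => /and3P[/andP[/negbTE-> _] yl ul] /and3P[_ y0 l0] /=.
  by rewrite IH //= ?yl // inE negb_or y0.
case: w uw w0 => // x l uw w0 _; rewrite rcons_cons /= gen // addn0.
by move: w0; rewrite inE negb_or => /andP[/negbTE ->].
Qed.

Lemma qs_sum_excess0 r c :
  uniq (r :: unzip1 c) -> excess c = 0%N -> (0 < size c)%N ->
  qs_sum t u v r c = Apoly (size c) t u.
Proof.
move=> urc c0 c_gt0; rewrite /qs_sum /qs_words expand_excess0 //.
have uc : uniq (unzip1 c) by case/andP: urc.
have szc : size c = size (unzip1 c) by rewrite size_map.
set s := unzip1 c in urc uc szc *.
rewrite (_ : [seq _ <- _ | _] = permutations s); last first.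
  apply/all_filterP/allP => w; rewrite mem_permutations => /perm_uniq ws.
  by apply: quasi_stirling_uniq; rewrite ws.
rewrite /Apoly szc -(perm_big _ (perm_permutations (perm_rotated_rank urc))) /=.
rewrite -(perm_big _ (perm_permutations_map uc _)) /=; last first.
  by move=> x y xs ys; apply: (rotated_rank_inj urc); rewrite inE ?xs ?ys orbT.
rewrite big_map; apply: eq_big_seq => w; rewrite mem_permutations => pw.
have ws : {subset w <= s} by move=> x; rewrite (perm_mem pw).
have [e1 e2 e3] := steps_rotated_rank urc ws.
rewrite /weight /pweight e1 e2 e3 -des_steps -asc_steps -plat_steps.
have pg : perm_eq (map (rotated_rank r s) w) (iota 1 (size s)).
  exact: perm_trans (perm_map _ pw) (perm_rotated_rank urc).
rewrite plat_uniq ?expr0 ?mulr1 //.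
- by rewrite (perm_uniq pg) iota_uniq.
- by rewrite (perm_mem pg) mem_iota.
by rewrite -size_eq0 (perm_size pg) size_iota -szc -lt0n.
Qed.

Lemma qs_sum_nil r : qs_sum t u v r [::] = v.
Proof.
rewrite /qs_sum /qs_words (_ : permutations _ = [:: [::]]) //=.
rewrite quasi_stirling_uniq // big_seq1.
by rewrite /weight /pweight /= ltnn eqxx /= !mul1r.
Qed.

End Base.

(** * The convolution identity *)

Lemma big_splits_size (V : nmodType) (T : Type) (s : seq T)
    (h : nat -> nat -> V) :
  \sum_(AB <- splits s) h (size AB.1) (size AB.2) =
  \sum_(j < (size s).+1) h j (size s - j)%N *+ 'C(size s, j).
Proof.
elim: s h => [|x s IH] h /=; first by rewrite big_seq1 big_ord1.
rewrite big_cat !big_map /=.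
rewrite (IH (fun i j => h i.+1 j)) (IH (fun i j => h i j.+1)).
set n := size s.
rewrite [RHS]big_ord_recl /= bin0 subn0.
under [X in _ = _ + X]eq_bigr => i _.
  rewrite /bump /= add1n binS mulrnDr subSS; over.
rewrite big_split /= addrA [RHS]addrC; congr (_ + _).
rewrite big_ord_recl /= bin0 subn0; congr (_ + _).
rewrite [RHS]big_ord_recr /= bin_small // mulr0n addr0.
by apply: eq_bigr => i _; rewrite /bump /= add1n -subSn.
Qed.

(** Truncation to a polynomial gives access to the derivative of a power. *)
Lemma fps_exp_coef (R : comNzRingType) (f : fps R) N m n : (n < N)%N ->
  fps_exp f m n = ((\poly_(i < N) f i) ^+ m)`_n.
Proof.
elim: m n => [|m IH] n nN; first by rewrite expr0 coef1; case: n nN.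
rewrite exprS coefM [LHS]/=; apply: eq_bigr => i _.
by rewrite coef_poly IH ?(leq_ltn_trans _ nN) ?leq_subr // -ltnS ltn_ord.
Qed.

Section Egf.
Variables (R : comAlgType rat) (f : fps R).

(** Here [k] is to be [K - n + 1], the number of blocks of the noncrossing
    partition complementary to the one that a word defines on the circle: the
    gaps of the word fall into these blocks, and each block, a cyclic sequence
    of distinct letters, accounts for one factor [f]. *)
Definition tree_coef (n k : nat) : R := (n`!%:R / k%:R : rat) *: fps_exp f k n.

Lemma tree_coef1 n : tree_coef n 1 = (n`!%:R : rat) *: f n.
Proof.
by rewrite /tree_coef divr1 (@fps_exp_coef _ _ n.+1) // expr1 coef_poly ltnSn.
Qed.

(** Up to the common factor [n!], the left side is the coefficient of [z^n] in
    [(1/k) (f^k)' f], which is [f' f^k], and the right side is that of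
    [(1/(k+1)) (f^(k+1))'], which is [f' f^k] again. *)
Lemma tree_coefS n k : (0 < k)%N ->
  \sum_(j < n.+1) (tree_coef j.+1 k * tree_coef (n - j) 1) *+ 'C(n, j)
  = tree_coef n.+1 k.+1.
Proof.
move=> k_gt0; pose P := \poly_(i < n.+2) f i.
have fE m j : (j <= n.+1)%N -> fps_exp f m j = (P ^+ m)`_j.
  by move=> jn; rewrite (@fps_exp_coef _ _ n.+2).
have natV (m : nat) : (0 < m)%N -> (m%:R : rat) != 0.
  by move=> m0; rewrite Num.Theory.pnatr_eq0 -lt0n.
have -> : tree_coef n.+1 k.+1 = (n`!%:R : rat) *: (P^`() * P ^+ k)`_n.
  rewrite /tree_coef fE //.
  have := congr1 (fun p : {poly R} => p`_n) (deriv_exp P k.+1).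
  rewrite coef_deriv coefMn /= -!(@scaler_nat rat) => e.
  by rewrite factS mulnC natrM mulrAC -scalerA e scalerA divfK ?natV.
transitivity ((n`!%:R / k%:R : rat) *: ((P ^+ k)^`() * P)`_n); last first.
  rewrite deriv_exp [_ * P]mulrnAl -[_ * P]mulrA -exprSr prednK // coefMn.
  by rewrite -(@scaler_nat rat) scalerA divfK ?natV.
rewrite coefM scaler_sumr; apply: eq_bigr => j _.
have jn : (j <= n)%N by rewrite -ltnS ltn_ord.
rewrite tree_coef1 /tree_coef coef_deriv -[_`_ _ *+ _](@scaler_nat rat).
rewrite fE; last exact: ltn_ord.
rewrite coef_poly (leq_ltn_trans (leq_subr j n)) // -(bin_fact jn).
rewrite -!scalerAl -scalerAr -[LHS](@scaler_nat rat) !scalerA.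
by congr (_ *: _); rewrite factS !natrM; ring.
Qed.

End Egf.

(** * Independence of the root and of the distribution of the excess *)

Section TreeSum.
Variables (R : comAlgType rat) (t u v : R) (f : fps R).
Hypothesis f0 : f 0%N = v.
Hypothesis f_Apoly : forall n, (0 < n)%N -> (n`!%:R : rat) *: f n = Apoly n t u.

Local Notation Q := (qs_sum t u v).
Local Notation T := (tree_coef f).

(** The quantification over the root is essential for the induction, since
    peeling creates sums with another root. *)
Definition closed_form (c : content) : Prop :=
  forall r, uniq (r :: unzip1 c) -> Q r c = T (size c) (excess c).+1.

Lemma closed_form_perm c1 c2 :
  perm_eq c1 c2 -> closed_form c1 -> closed_form c2.
Proof.
move=> c12 cl r ur; rewrite -(qs_sum_perm _ _ _ _ c12) -(perm_size c12).
rewrite -(excess_perm c12); apply: cl.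
by have := perm_map fst c12; rewrite -(perm_cons r) => /perm_uniq ->.
Qed.

Lemma closed_form_excess0 c : excess c = 0%N -> closed_form c.
Proof.
move=> c0 r ur; rewrite c0 tree_coef1; have [c_gt0 | ] := ltnP 0 (size c).
  by rewrite f_Apoly // qs_sum_excess0.
by case: c {c0 ur} => // _; rewrite qs_sum_nil f0 scale1r.
Qed.

Section Step.
Variable N : nat.
Hypothesis IH : forall c, (size c + excess c < N)%N -> closed_form c.

Lemma splits_bound (c A B : content) : (A, B) \in splits c ->
  [/\ (size A + size B = size c)%N, (excess A + excess B = excess c)%N
    & perm_eq (A ++ B) c].
Proof.
move=> /splits_perm pAB; split=> //; first by rewrite -size_cat (perm_size pAB).
by rewrite -excess_cat (excess_perm pAB).
Qed.

Lemma peel_IH r a e c :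
  (size c + excess c + e.+1 < N)%N -> uniq (r :: a :: unzip1 c) ->
  Q r ((a, e.+1) :: c) =
  \sum_(AB <- splits c)
     T (size AB.1).+1 (e + excess AB.1).+1 * T (size AB.2) (excess AB.2).+1.
Proof.
move=> cN urac; have uac : uniq (a :: unzip1 c) by case/andP: urac.
rewrite qs_sum_peel //; apply: eq_big_seq => -[A B] AB /=.
have [sAB eAB pAB] := splits_bound AB.
have uAB : uniq (r :: a :: unzip1 A ++ unzip1 B).
  have := perm_map fst pAB; rewrite map_cat -(perm_cons a) -(perm_cons r).
  by move/perm_uniq ->.
congr (_ * _); apply: IH; rewrite ?excess_cons /=; try lia.
  by move: uAB; rewrite -!cat_cons cat_uniq => /and3P[].
move: uAB => /= /andP[_ /andP[]]; rewrite mem_cat negb_or => /andP[_ ->].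
by rewrite cat_uniq => /and3P[].
Qed.

(** When [a] carries all the excess, the summand of the peeling identity depends
    on the sizes of the two parts only. *)
Lemma peel_one_excess r a e c :
  (size c + excess c + e.+1 < N)%N -> excess c = 0%N ->
  uniq (r :: a :: unzip1 c) -> Q r ((a, e.+1) :: c) = T (size c).+1 e.+2.
Proof.
move=> cN c0 ur; rewrite peel_IH // -tree_coefS //.
rewrite -(big_splits_size c (fun i j => T i.+1 e.+1 * T j 1)).
apply: eq_big_seq => -[A B] /splits_bound[_ + _] /=; rewrite c0 => /eqP.
by rewrite addn_eq0 => /andP[/eqP -> /eqP ->]; rewrite addn0.
Qed.

(** Both sides are expanded by peeling, [b] on the left and [a] on the right.
    Where the other letter stays with the root, the terms coincide; where it
    goes into the gap, they coincide after exchanging the two parts. *)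
Lemma move_excess r a b e g c : (size c + excess c + e.+1 + g.+2 < N)%N ->
  uniq (r :: a :: b :: unzip1 c) ->
  Q r ((a, e.+1) :: (b, g.+1) :: c) = Q r ((a, e.+2) :: (b, g) :: c).
Proof.
move=> cN ur.
rewrite (qs_sum_perm _ _ _ _ (perm_swap (a, e.+1) (b, g.+1) c)).
rewrite !peel_IH //; try by rewrite ?excess_cons /=; lia.
  rewrite /= !big_cat !big_map /=; congr (_ + _).
    by apply: eq_bigr => AB _; rewrite !excess_cons /= addnCA.
  rewrite [RHS](big_splits_swap c (fun A B =>
     T (size A).+1 (e.+1 + excess A).+1 * T (size B).+1 (g + excess B).+1)).
  by apply: eq_bigr => AB _; rewrite mulrC.
move: ur; have := perm_swap a b (unzip1 c).
by rewrite -(perm_cons r) => /perm_uniq ->.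
Qed.

End Step.

Lemma qs_sum_closed_form c : closed_form c.
Proof.
have [N] := ubnP (size c + excess c)%N; elim: N c => // N IH c.
rewrite ltnS leq_eqVlt => /orP[/eqP cN | /IH //].
have {}IH c' : (size c' + excess c' < N)%N -> closed_form c' by move/IH.
have [|] := posnP (excess c); first exact: closed_form_excess0.
move=> /excess_gt0[a [e [c0 pc]]].
apply: (@closed_form_perm ((a, e.+1) :: c0)); first by rewrite perm_sym.
move: cN; rewrite (perm_size pc) (excess_perm pc) {c pc} excess_cons /= => cN.
(* Inner induction: the excess carried by the letters other than [a]. *)
have [m] := ubnP (excess c0); elim: m e c0 cN => // m IHm e c0 cN.
rewrite ltnS => c0m r ur.
have [c00 | /excess_gt0[b [g [c1 pc]]]] := posnP (excess c0).
  rewrite (peel_one_excess IH) //; last by lia.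
  by rewrite excess_cons /= c00 addn0.
have pc' : perm_eq ((a, e.+1) :: c0) ((a, e.+1) :: (b, g.+1) :: c1).
  by rewrite perm_cons.
move: cN c0m; rewrite (excess_perm pc) (perm_size pc) !excess_cons /= => cN c1m.
rewrite (excess_perm pc) excess_cons /=.
have ur1 : uniq (r :: a :: b :: unzip1 c1).
  by have := perm_map fst pc'; rewrite -(perm_cons r) => /perm_uniq <-.
rewrite (qs_sum_perm _ _ _ _ pc') (move_excess IH) //; last by lia.
rewrite (IHm e.+1 ((b, g) :: c1)) //; try by rewrite excess_cons /=; lia.
by rewrite excess_cons /= (perm_size pc) /= !addSn !addnS.
Qed.

End TreeSum.

Theorem corollary1p5 (n : nat) (hn : (1 <= n)%N)
    (k : 'I_n -> nat) (hk : forall i : 'I_n, (1 <= k i)%N)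
    (K : nat) (hK : K = (\sum_(i < n) k i)%N) :
  Qbar k var_t var_u var_v =
  (n`!%:R / (K - n + 1)%N%:R : rat) *:
    fps_coef n
      (fps_exp (fps_add (fps_sub (Atilde var_t var_u) (fps_const 1))
                        (fps_const var_v))
               (K - n + 1)).
Proof.
set f := fps_add _ _.
pose c : content := [seq (i.+1, (k i).-1) | i : 'I_n <- enum 'I_n].
have size_c : size c = n by rewrite size_map size_enum_ord.
have excess_c : excess c = (K - n)%N.
  rewrite /excess /unzip2 -map_comp sumnE big_map big_enum /= hK.
  have -> : (\sum_(i < n) k i = \sum_(i < n) (k i).-1 + n)%N.
    have sum1 : (\sum_(i < n) 1 = n)%N by rewrite sum1_card card_ord.
    rewrite -[X in (_ + X)%N]sum1 -big_split /=.
    by apply: eq_bigr => i _; rewrite addn1 prednK.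
  by rewrite addnK.
have content_c : multiset k = expand c.
  rewrite /multiset /expand; congr flatten; rewrite /c -[RHS]map_comp.
  by apply: eq_map => i; rewrite /comp prednK.
have uniq_c : uniq (0%N :: unzip1 c).
  rewrite /= /unzip1 -map_comp map_inj_uniq ?enum_uniq ?andbT; last first.
    by move=> i j [] /val_inj.
  by apply/mapP => -[].
have f0 : f 0%N = var_v by rewrite /f /fps_add /fps_sub /= subrr add0r.
have fA m : (0 < m)%N -> (m`!%:R : rat) *: f m = Apoly m var_t var_u.
  case: m => // m _; rewrite /f /fps_add /fps_sub /= subr0 addr0 scalerA.
  by rewrite divff ?scale1r // Num.Theory.pnatr_eq0 -lt0n fact_gt0.
have := qs_sum_closed_form f0 fA uniq_c; rewrite size_c excess_c.
rewrite /fps_coef addn1 -/(tree_coef f n (K - n).+1) => <-.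
rewrite /qs_sum /qs_words -content_c.
by apply: eq_bigr => w _; rewrite weight0.
Qed.
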